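(* Let $F:\mathbb{R}^d\to\mathbb{R}^d$ be $L$-Lipschitz, $G:\mathbb{R}^d\rightrightarrows\mathbb{R}^d$ maximally monotone, the solution set of $0\in F(x)+G(x)$ nonempty, and suppose there is a nonempty subset of solutions each element $x^\star$ of which satisfies the $\rho$-weak MVI: $\langle u,x-x^\star\rangle\ge-\rho\|u\|^2$ for all $(x,u)$ in the graph of $F+G$, where $\rho>0$. Let $\eta<\frac1L$ and suppose $\rho<\eta$. Let $x^\star$ be such a solution and $(x_k)$ be generated by the inexact KM iteration in the context. Then for any $K\ge1$, $$\frac1K\sum_{k=0}^{K-1}\frac1{\eta^2}\|x_k-J_{\eta(F+G)}(x_k)\|^2\le\frac{11\|x_0-x^\star\|^2}{(\eta-\rho)^2K}.$$ The number of first-order oracle calls used at iteration $k$ is at most $2N_k$, where $N_k=\left\lceil\frac{4(1+\eta L)}{1-\eta L}\log\big(8(k+1)\log^2(k+2)\big)\right\rceil$.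
   Context: For an operator $A$, $J_A=(\mathrm{Id}+A)^{-1}$. A first-order oracle call is one evaluation of $F$ and one resolvent of (a positive multiple of) $G$. Subroutine FBF$(z_0,N,A,B_{\mathrm{in}},L_B)$: $\tau=\frac{1}{2L_B}$, $B(\cdot)=B_{\mathrm{in}}(\cdot)-z_0$; for $t=0,\dots,N-1$: $z_{t+1/2}=J_{\tau A}(z_t-\tau B(z_t))$, $z_{t+1}=z_{t+1/2}+\tau B(z_t)-\tau B(z_{t+1/2})$; output $z_N$. Inexact KM iteration: given $x_0\in\mathbb{R}^d$, $\alpha=1-\frac\rho\eta$; for $k=0,\dots,K-1$: $\widetilde J_{\eta(F+G)}(x_k)=\mathrm{FBF}(x_k,N_k,\eta G,\mathrm{Id}+\eta F,1+\eta L)$ with $N_k=\left\lceil\frac{4(1+\eta L)}{1-\eta L}\log(8(k+1)\log^2(k+2))\right\rceil$, and $x_{k+1}=(1-\alpha)x_k+\alpha\widetilde J_{\eta(F+G)}(x_k)$. *)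

(* Defs.v *)
From HB Require Import structures.
From mathcomp Require Import all_boot all_order all_algebra.
From mathcomp Require Import all_classical all_reals all_analysis.
Set Implicit Arguments. Unset Strict Implicit. Unset Printing Implicit Defensive.
Import Order.TTheory GRing.Theory Num.Theory.
Local Open Scope ring_scope.
Local Open Scope classical_set_scope.

Section Defs.
Variables (R : realType) (d : nat).
Local Notation V := 'rV[R]_d.

Definition dotp (u v : V) : R := (u *m v^T) 0 0.
Definition enorm (u : V) : R := Num.sqrt (dotp u u).

Definition lipschitz_with (F : V -> V) (L : R) : Prop :=
  forall x y, enorm (F x - F y) <= L * enorm (x - y).

Definition monotone_op (A : V -> set V) : Prop :=
  forall x y u v, A x u -> A y v -> 0 <= dotp (u - v) (x - y).

Definition maximally_monotone (A : V -> set V) : Prop :=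
  monotone_op A /\
  forall B : V -> set V, monotone_op B -> (forall x, A x `<=` B x) ->
    forall x, B x `<=` A x.

Definition op_sum (F : V -> V) (G : V -> set V) : V -> set V :=
  fun x => [set F x + u | u in G x].

Definition op_scale (c : R) (A : V -> set V) : V -> set V :=
  fun x => [set c *: u | u in A x].

(* J_A = (Id + A)^{-1}: p = J_A z  iff  z - p ∈ A p.  (Single-valued whenever
   A is monotone; chosen by xget, default 0 if no such p exists.) *)
Definition resolvent (A : V -> set V) (z : V) : V := xget 0 [set p | A p (z - p)].

Definition weak_MVI (A : V -> set V) (rho : R) (xs : V) : Prop :=
  forall x u, A x u -> - rho * enorm u ^+ 2 <= dotp u (x - xs).

Definition fbf_step (A : V -> set V) (B : V -> V) (tau : R) (z : V) : V :=
  let zh := resolvent (op_scale tau A) (z - tau *: B z) in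
  zh + tau *: B z - tau *: B zh.

(* FBF(z0, N, A, B_in, L_B), instrumented: returns (z_N, #F-evaluations,
   #resolvent evaluations). Each step evaluates B (hence F) at z_t and at
   z_{t+1/2}, and one resolvent. *)
Definition FBF_counted (z0 : V) (N : nat) (A : V -> set V) (Bin : V -> V) (LB : R)
  : V * nat * nat :=
  let tau := (2 * LB)^-1 in
  let B := fun z => Bin z - z0 in
  iter N (fun c => (fbf_step A B tau c.1.1, c.1.2 + 2, c.2 + 1)%N) (z0, 0%N, 0%N).

Definition FBF (z0 : V) (N : nat) (A : V -> set V) (Bin : V -> V) (LB : R) : V :=
  (FBF_counted z0 N A Bin LB).1.1.

(* number of first-order oracle calls (one F evaluation + one resolvent each) *)
Definition FBF_oracle_calls (z0 : V) (N : nat) (A : V -> set V) (Bin : V -> V) (LB : R)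
  : nat :=
  let c := FBF_counted z0 N A Bin LB in maxn c.1.2 c.2.

Definition Nk (eta L : R) (k : nat) : nat :=
  `| Num.ceil (4 * (1 + eta * L) / (1 - eta * L)
               * ln (8 * k.+1%:R * (ln k.+2%:R) ^+ 2)) |%N.

Definition inexact_resolvent (F : V -> V) (G : V -> set V) (L eta : R) (k : nat) (x : V) : V :=
  FBF x (Nk eta L k) (op_scale eta G) (fun z => z + eta *: F z) (1 + eta * L).

Definition oracle_calls_at (F : V -> V) (G : V -> set V) (L eta : R) (k : nat) (x : V) : nat :=
  FBF_oracle_calls x (Nk eta L k) (op_scale eta G) (fun z => z + eta *: F z) (1 + eta * L).

Fixpoint KM (F : V -> V) (G : V -> set V) (L eta rho : R) (x0 : V) (k : nat) : V :=
  match k with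
  | 0 => x0
  | k'.+1 =>
      let x := KM F G L eta rho x0 k' in
      let alpha := 1 - rho / eta in
      (1 - alpha) *: x + alpha *: inexact_resolvent F G L eta k' x
  end.

End Defs.

(* Main.v *)
(* A maximally monotone operator has everywhere defined resolvents (Minty's
   theorem, obtained here by maximizing a strongly concave dual function over
   the convex hull of the graph), and J = J_{eta(F+G)} is then reached by
   Picard iteration since eta L < 1.  The operator Id + eta F is
   (1 - eta L)-strongly monotone and (1 + eta L)-Lipschitz, so each FBF step
   shrinks the squared distance to J x by exp(- kappa/2) with
   kappa = (1 - eta L)/(1 + eta L), and N_k steps give
   |J~ x_k - J x_k| <= e_k |x_k - J x_k| with e_k = 1/(8 (k+1) ln^2 (k+2)).
   The weak MVI gives <x - J x, x - x*> >= alpha |x - J x|^2, hence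
   |x_{k+1} - x*|^2 + 3/4 alpha^2 |x_k - J x_k|^2 <= (1 + e_k) |x_k - x*|^2.
   Finally sum_k e_k <= 7/8 and exp(7/8) <= 8 < 11 * 3/4. *)
Require Import Defs.
From HB Require Import structures.
From mathcomp Require Import all_boot all_order all_algebra.
From mathcomp Require Import all_classical all_reals all_analysis.
From mathcomp Require Import ring lra.
Import Order.TTheory GRing.Theory Num.Theory.
Import numFieldNormedType.Exports.
Local Open Scope ring_scope.
Local Open Scope classical_set_scope.

(** * Euclidean inner product, completeness, and fixed points of contractions *)

Section EuclideanSpace.
Set Implicit Arguments.
Unset Strict Implicit.
Variables (R : realType) (d : nat).
Local Notation V := 'rV[R]_d.
Implicit Types (u v w x y z : V) (a c : R).

Lemma dotp_sum u v : dotp u v = \sum_i u 0 i * v 0 i.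
Proof. by rewrite /dotp mxE; apply: eq_bigr => i _; rewrite mxE. Qed.

Lemma dotpC u v : dotp u v = dotp v u.
Proof. by rewrite !dotp_sum; apply: eq_bigr => i _; rewrite mulrC. Qed.

Lemma dotpDl u v w : dotp (u + v) w = dotp u w + dotp v w.
Proof. by rewrite /dotp mulmxDl mxE. Qed.

Lemma dotpDr u v w : dotp u (v + w) = dotp u v + dotp u w.
Proof. by rewrite dotpC dotpDl !(dotpC u). Qed.

Lemma dotpZl a u v : dotp (a *: u) v = a * dotp u v.
Proof. by rewrite /dotp -scalemxAl mxE. Qed.

Lemma dotpZr a u v : dotp u (a *: v) = a * dotp u v.
Proof. by rewrite dotpC dotpZl dotpC. Qed.

Lemma dotpNl u v : dotp (- u) v = - dotp u v.
Proof. by rewrite -scaleN1r dotpZl mulN1r. Qed.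

Lemma dotpNr u v : dotp u (- v) = - dotp u v.
Proof. by rewrite dotpC dotpNl dotpC. Qed.

Lemma dotp0l u : dotp 0 u = 0.
Proof. by rewrite -(scale0r u) dotpZl mul0r. Qed.

Lemma dotp0r u : dotp u 0 = 0.
Proof. by rewrite dotpC dotp0l. Qed.

Definition dotpE := (dotpDl, dotpDr, dotpNl, dotpNr, dotpZl, dotpZr).

Lemma dotp_ge0 u : 0 <= dotp u u.
Proof. by rewrite dotp_sum sumr_ge0 // => i _; rewrite -expr2 sqr_ge0. Qed.

Lemma sqr_coord_le_dotp u i : u 0 i ^+ 2 <= dotp u u.
Proof.
rewrite dotp_sum (bigD1 i) //= -expr2 lerDl sumr_ge0 // => j _.
by rewrite -expr2 sqr_ge0.
Qed.

Lemma dotp_eq0 u : dotp u u <= 0 -> u = 0.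
Proof.
move=> u0; apply/rowP => i; rewrite mxE; apply/eqP.
rewrite -sqrf_eq0 eq_le sqr_ge0 andbT.
exact: le_trans (sqr_coord_le_dotp u i) u0.
Qed.

Lemma dotpB_sym u v : dotp (u - v) (u - v) = dotp (v - u) (v - u).
Proof. by rewrite -opprB dotpNl dotpNr opprK. Qed.

Lemma enorm_sqr u : enorm u ^+ 2 = dotp u u.
Proof. by rewrite sqr_sqrtr // dotp_ge0. Qed.

Lemma enorm_ge0 u : 0 <= enorm u. Proof. exact: sqrtr_ge0. Qed.

Lemma enorm_le u c : 0 <= c -> (enorm u <= c) = (dotp u u <= c ^+ 2).
Proof. by move=> c0; rewrite -enorm_sqr ler_sqr // nnegrE enorm_ge0. Qed.

Lemma enormZ c u : 0 <= c -> enorm (c *: u) = c * enorm u.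
Proof.
by move=> c0; rewrite /enorm dotpZl dotpZr mulrA -expr2 sqrtrM ?sqr_ge0 // sqrtr_sqr ger0_norm.
Qed.

Lemma cauchy_schwarz u v : `|dotp u v| <= enorm u * enorm v.
Proof.
have [v0|] := eqVneq (dotp v v) 0.
  have -> : v = 0 by apply: dotp_eq0; rewrite v0.
  by rewrite dotp0r normr0 mulr_ge0 ?enorm_ge0.
move=> vn0; have v0 : 0 < dotp v v by rewrite lt_neqAle eq_sym vn0 dotp_ge0.
rewrite -ler_sqr ?nnegrE ?mulr_ge0 ?enorm_ge0 // exprMn !enorm_sqr real_normK ?num_real //.
have := dotp_ge0 (dotp v v *: u - dotp u v *: v).
rewrite !dotpE (dotpC v u).
set p := dotp u v; set q := dotp u u; set s := dotp v v => H.
have : 0 <= s * (q * s - p ^+ 2) by move: H; rewrite -/s; lra.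
by rewrite pmulr_rge0 // subr_ge0.
Qed.

Lemma dotp_le_of_sqr c u v : 0 <= c -> dotp u u <= c ^+ 2 * dotp v v ->
  `|dotp u v| <= c * dotp v v.
Proof.
move=> c0; rewrite -!enorm_sqr -exprMn ler_sqr ?nnegrE ?mulr_ge0 ?enorm_ge0 // => H.
rewrite (le_trans (cauchy_schwarz u v)) // expr2 mulrA ler_wpM2r ?enorm_ge0 //.
Qed.

Lemma enormD u v : enorm (u + v) <= enorm u + enorm v.
Proof.
rewrite enorm_le ?addr_ge0 ?enorm_ge0 // !dotpE (dotpC v u) -!enorm_sqr.
have := cauchy_schwarz u v; have := ler_norm (dotp u v); lra.
Qed.

Lemma lipschitz_with_sqr (F : V -> V) c : lipschitz_with F c -> forall x y,
  dotp (F x - F y) (F x - F y) <= c ^+ 2 * dotp (x - y) (x - y).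
Proof.
move=> Flip x y; rewrite -!enorm_sqr -exprMn ler_sqr ?nnegrE ?enorm_ge0 //.
exact: le_trans (enorm_ge0 _) (Flip x y).
Qed.

(** Completeness of the reals is used coordinate by coordinate. The limit is described only through
    squared distances to arbitrary points, the form in which both later limit arguments need it. *)
Lemma cauchy_dotp_cvg (x : nat -> V) (e : nat -> R) : e @ \oo --> 0 ->
    (forall n m, (n <= m)%N -> dotp (x n - x m) (x n - x m) <= e n) ->
  exists l : V, forall b : V, dotp (x n - b) (x n - b) @[n --> \oo] --> dotp (l - b) (l - b).
Proof.
move=> e0 He.
have cvgx i : cvg ((fun n => x n 0 i) @ \oo).
  apply/cauchy_cvgP/cauchy_exP => _/posnumP[eps].
  have eps2 : 0 < eps%:num ^+ 2 by rewrite exprn_gt0.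
  have [N _ HN] := cvgr_lt _ e0 _ eps2.
  exists (x N 0 i); exists N => // n /= Nn.
  rewrite /ball /= -ltr_sqr ?nnegrE // real_normK ?num_real //.
  apply: le_lt_trans (HN N (leqnn N)).
  apply: le_trans (He N n Nn).
  by have := sqr_coord_le_dotp (x N - x n) i; rewrite !mxE.
exists (\row_i lim ((fun n => x n 0 i) @ \oo)) => b.
rewrite dotp_sum.
rewrite (_ : (fun n => _) = (fun n => \sum_i (x n - b) 0 i * (x n - b) 0 i)); last first.
  by apply/funext => n; rewrite dotp_sum.
apply: cvg_big; first by move=> t; apply: add_continuous.
move=> i _; rewrite !mxE.
rewrite (_ : (fun n => _) = (fun n => (x n 0 i - b 0 i) * (x n 0 i - b 0 i))); last first.
  by apply/funext => n; rewrite !mxE.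
have Hi : (x n 0 i - b 0 i) @[n --> \oo] --> lim (x n 0 i @[n --> \oo]) - b 0 i.
  by apply: cvgB; [exact: cvgx | exact: cvg_cst].
exact: cvgM.
Qed.

Lemma contraction_fixpoint (T : V -> V) c : 0 <= c < 1 ->
    (forall x y, enorm (T x - T y) <= c * enorm (x - y)) ->
  exists p, T p = p.
Proof.
move=> /andP[c0 c1] HT.
pose x n := iter n T 0.
(* Sum of the geometric series with first term [|x 1 - x 0|] and ratio [c]. *)
pose M := enorm (x 1%N - x 0%N) / (1 - c).
have c1' : 0 < 1 - c by rewrite subr_gt0.
have M0 : 0 <= M by rewrite divr_ge0 ?enorm_ge0 // ltW.
have E : enorm (x 0%N - x 1%N) = (1 - c) * M.
  by rewrite /M mulrC divfK ?gt_eqF // /enorm dotpB_sym.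
clearbody M.
have bnd n : enorm (x 0%N - x n) <= M.
  elim: n => [|n IH].
    by rewrite subrr enorm_le // dotp0l sqr_ge0.
  rewrite (_ : x 0%N - x n.+1 = (x 0%N - x 1%N) + (T (x 0%N) - T (x n))); last first.
    by rewrite /= addrA subrK.
  apply: (le_trans (enormD _ _)).
  have : c * enorm (x 0%N - x n) <= c * M by rewrite ler_wpM2l.
  have := HT (x 0%N) (x n); rewrite E; lra.
have dist n j : enorm (x n - x (j + n)%N) <= c ^+ n * M.
  elim: n => [|n IH]; first by rewrite addn0 expr0 mul1r.
  rewrite addnS /=; apply: (le_trans (HT _ _)).
  by rewrite exprS -mulrA ler_wpM2l.
have [] := @cauchy_dotp_cvg x (fun n => (c ^+ 2) ^+ n * M ^+ 2).
- rewrite -[X in _ --> X](mul0r (M ^+ 2)); apply: cvgM; last exact: cvg_cst.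
  by apply: cvg_expr; rewrite ger0_norm ?sqr_ge0 // expr_lt1.
- move=> n m nm; rewrite -exprM mulnC exprM -exprMn -enorm_le ?mulr_ge0 ?exprn_ge0 //.
  by rewrite -(subnK nm).
move=> l Hl; exists l.
suff /subr0_eq <- : l - T l = 0 by [].
apply: dotp_eq0.
have H1 : dotp (x n.+1 - T l) (x n.+1 - T l) @[n --> \oo] --> dotp (l - T l) (l - T l).
  by have := Hl (T l); rewrite -(cvg_shiftS (fun n => dotp (x n - T l) (x n - T l))).
(* Since [|x n.+1 - T l| <= |x n - l|], the limits give [|l - T l| <= 0]. *)
have := ler_cvg_to H1 (Hl l); rewrite (subrr l) dotp0l; apply.
apply: nearW => n; rewrite -!enorm_sqr ler_sqr ?nnegrE ?enorm_ge0 //=.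
apply: (le_trans (HT _ _)); rewrite ler_piMl ?enorm_ge0 //; exact: ltW.
Qed.

End EuclideanSpace.

(** * Minty's theorem by convex duality *)

Section Minty.
Set Implicit Arguments.
Unset Strict Implicit.
Variables (R : realType) (d : nat).
Local Notation V := 'rV[R]_d.
Implicit Types (A : V -> set V).

(** Convex hull of the points [(dotp u v, u, v)] over the graph of [A], generated by two-point
    mixtures so that inequalities pass to it by induction. *)
Inductive graph_hull A : R -> V -> V -> Prop :=
| graph_hull_point u v : A u v -> graph_hull A (dotp u v) u v
| graph_hull_mix t a u v b x y : 0 <= t <= 1 ->
    graph_hull A a u v -> graph_hull A b x y ->
    graph_hull A ((1 - t) * a + t * b)
      ((1 - t) *: u + t *: x) ((1 - t) *: v + t *: y).

(* Both sides are affine in each of the two points, so that only pairs of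
   points of the graph matter. *)
Lemma graph_hull_monotone A a u v b x y : monotone_op A ->
  graph_hull A a u v -> graph_hull A b x y -> dotp u y + dotp x v <= a + b.
Proof.
move=> Amon Hp Hq.
suff H u1 v1 : A u1 v1 -> dotp u1 y + dotp x v1 <= dotp u1 v1 + b.
  elim: Hp => [u1 v1 /H //|t a1 u1 v1 a2 u2 v2 /andP[t0 t1] _ H1 _ H2].
  rewrite !dotpE.
  have : (1 - t) * (dotp u1 y + dotp x v1) <= (1 - t) * (a1 + b).
    by rewrite ler_wpM2l // subr_ge0.
  have : t * (dotp u2 y + dotp x v2) <= t * (a2 + b) by rewrite ler_wpM2l.
  lra.
move=> Auv; elim: Hq => [u2 v2 Auv2|t a1 u2 v2 a2 u3 v3 /andP[t0 t1] _ H1 _ H2].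
  by have := Amon _ _ _ _ Auv Auv2; rewrite !dotpE !(dotpC v1) !(dotpC v2); lra.
rewrite !dotpE.
have : (1 - t) * (dotp u1 v2 + dotp u2 v1) <= (1 - t) * (dotp u1 v1 + a1).
  by rewrite ler_wpM2l // subr_ge0.
have : t * (dotp u1 v3 + dotp u3 v1) <= t * (dotp u1 v1 + a2) by rewrite ler_wpM2l.
lra.
Qed.

Definition center (u v : V) : V := 2^-1 *: (u - v).

(* The minimum over [x] of the quadratic [dotp x x + dotp x (v - u) - a],
   attained at [center u v]. *)
Definition dual_value (a : R) (u v : V) : R := - a - dotp (center u v) (center u v).

(** Monotonicity on the hull, with both points equal, gives [dotp u v <= a], and then the dual value
    is at most [- |u + v|^2 / 4]. *)
Lemma dual_value_le0 A a u v : monotone_op A -> graph_hull A a u v ->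
  dual_value a u v <= 0.
Proof.
move=> Amon H; have := graph_hull_monotone Amon H H; have := dotp_ge0 (u + v).
by rewrite /dual_value /center !dotpE !(dotpC v u); lra.
Qed.

(** Strong concavity in exact form: [center] is linear, and the last term is the gap in the
    convexity of the squared norm. *)
Lemma dual_value_mix t a u v b x y :
  dual_value ((1 - t) * a + t * b) ((1 - t) *: u + t *: x) ((1 - t) *: v + t *: y)
  = (1 - t) * dual_value a u v + t * dual_value b x y
    + t * (1 - t) * dotp (center u v - center x y) (center u v - center x y).
Proof.
rewrite /dual_value.
have -> : center ((1 - t) *: u + t *: x) ((1 - t) *: v + t *: y)
        = (1 - t) *: center u v + t *: center x y.
  by apply/rowP => i; rewrite !mxE; ring.
by move: (center u v) (center x y) => h k; rewrite !dotpE (dotpC k h); ring.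
Qed.

(** Completing the square: the left side is nonpositive exactly on the ball around [center u v] of
    squared radius [- dual_value (dotp u v) u v]. *)
Lemma dotp_center u v x :
  dotp (x + v) (x - u) = dual_value (dotp u v) u v + dotp (center u v - x) (center u v - x).
Proof. by rewrite /dual_value /center !dotpE !(dotpC v) !(dotpC u x); field. Qed.

(* Each inequality says that [x] lies in a closed ball.  A sequence maximizing
   the dual value over the hull of the graph has Cauchy centers, by strong
   concavity, and their limit lies in all the balls. *)
Lemma monotone_balls_meet A : monotone_op A ->
  exists x, forall u v, A u v -> dotp (x + v) (x - u) <= 0.
Proof.
move=> Amon.
have [[[u0 v0] /= A0]|noA] := pselect (exists p, A p.1 p.2); last first.
  by exists 0 => u v Auv; case: noA; exists (u, v).
pose E := [set r | exists p : R * V * V,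
  graph_hull A p.1.1 p.1.2 p.2 /\ r = dual_value p.1.1 p.1.2 p.2].
have E_ub : ubound E 0 by move=> r [p [Hp ->]]; exact: dual_value_le0 Hp.
have supE : has_sup E.
  split; last by exists 0.
  by exists (dual_value (dotp u0 v0) u0 v0), (dotp u0 v0, u0, v0); split => //; left.
set S := sup E.
have S0 : S <= 0 by apply: ge_sup => //; case: supE.
have leS a u v : graph_hull A a u v -> dual_value a u v <= S.
  by move=> H; apply: ub_le_sup; [exists 0|exists (a, u, v)].
have /choice[p Hp] : forall n : nat, exists p : R * V * V,
    graph_hull A p.1.1 p.1.2 p.2 /\ S - harmonic n < dual_value p.1.1 p.1.2 p.2.
  move=> n; have [//|r [q [Hq ->]] Hr] := @sup_adherent _ E (harmonic n) _ supE.
    by rewrite /harmonic /= invr_gt0.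
  by exists q.
pose x n := center (p n).1.2 (p n).2.
pose g n := dual_value (p n).1.1 (p n).1.2 (p n).2.
have gS n : S - harmonic n < g n by case: (Hp n).
have gleS n : g n <= S by apply: leS; case: (Hp n).
have harm0 : @harmonic R @ \oo --> 0 by exact: cvg_harmonic.
have [||l Hl] := @cauchy_dotp_cvg _ _ x (fun n => 4 * harmonic n).
- by rewrite -[X in _ --> X](mulr0 4); apply: cvgM => //; exact: cvg_cst.
- move=> n m nm.
  (* The midpoint has value at most [S], while both ends exceed [S - harmonic n]; the concavity gap,
     a quarter of the squared distance of the centers, is thus at most [harmonic n]. *)
  have /leS : graph_hull A ((1 - 2^-1) * (p n).1.1 + 2^-1 * (p m).1.1)
     ((1 - 2^-1) *: (p n).1.2 + 2^-1 *: (p m).1.2)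
     ((1 - 2^-1) *: (p n).2 + 2^-1 *: (p m).2).
    by right; [lra | case: (Hp n) | case: (Hp m)].
  rewrite dual_value_mix -/(g n) -/(g m) -/(x n) -/(x m).
  have : harmonic m <= harmonic n :> R by rewrite /harmonic /= lef_pV2 ?posrE // ler_nat ltnS.
  have := gS n; have := gS m; lra.
exists l => u v Auv; rewrite dotp_center dotpB_sym.
set h := center u v; set gj := dual_value _ _ _.
(* First-order optimality: mix the maximizing sequence with the point [(u, v)] at weight [t], let
   [n] grow, and divide by [t]. Afterwards [t] runs through [harmonic n] down to 0. *)
have key t : 0 < t <= 1 -> gj + (1 - t) * dotp (l - h) (l - h) <= S.
  move=> /andP[t0 t1].
  have : (gj - S) * t + t * (1 - t) * dotp (l - h) (l - h) <= 0.
    apply: (@ler_cvg_to _ \oo _ _ (fun n => (gj - S) * t + t * (1 - t) * dotp (x n - h) (x n - h))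
       (fun n => harmonic n)) => //.
      apply: cvgD; first exact: cvg_cst.
      by apply: cvgM; [exact: cvg_cst|exact: Hl].
    apply: nearW => n.
    have /leS : graph_hull A ((1 - t) * (p n).1.1 + t * dotp u v)
        ((1 - t) *: (p n).1.2 + t *: u) ((1 - t) *: (p n).2 + t *: v).
      by right; [rewrite (ltW t0) | case: (Hp n) | left].
    rewrite dual_value_mix -/(g n) -/(x n) -/h -/gj.
    have : t * g n <= t * S by rewrite ler_pM2l.
    have := gS n; lra.
  by move=> H; rewrite -subr_le0 -(pmulr_rle0 _ t0); lra.
apply: le_trans S0.
apply: (@ler_cvg_to _ \oo _ _ (fun n => gj + (1 - harmonic n) * dotp (l - h) (l - h))
   (fun=> S)); last 1 first.
- apply: nearW => n; apply: key; rewrite /harmonic /= invr_gt0 ltr0Sn /=.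
  by rewrite invf_le1 // ler1n.
- suff : (gj + (1 - harmonic n) * dotp (l - h) (l - h)) @[n --> \oo] -->
      gj + (1 - 0) * dotp (l - h) (l - h) by rewrite subr0 mul1r.
  apply: cvgD; first exact: cvg_cst.
  apply: cvgM; last exact: cvg_cst.
  by apply: cvgB => //; exact: cvg_cst.
- exact: cvg_cst.
Qed.

(** A point common to the balls of the shifted operator [A - z] makes [(p, z - p)] monotonically
    related to the whole graph of [A], so maximality puts it in the graph. *)
Theorem minty A z : maximally_monotone A -> exists p, A p (z - p).
Proof.
move=> [Amon Amax].
have [|p Hp] := @monotone_balls_meet (fun u => [set v | A u (v + z)]).
  by move=> u v x y Au Av; have := Amon _ _ _ _ Au Av; rewrite opprD addrACA subrr addr0.
exists p.
apply: (Amax (fun u => A u `|` [set v | u = p /\ v = z - p])); last by right.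
  have H u v : A u v -> 0 <= dotp (z - p - v) (p - u).
    move=> Auv; have := Hp u (v - z); rewrite /= subrK => /(_ Auv).
    rewrite (_ : p + (v - z) = - (z - p - v)) ?dotpNl ?oppr_le0 //.
    by rewrite !opprB addrCA.
  move=> x y u v [Axu|[-> ->]] [Ayv|[-> ->]].
  - exact: Amon.
  - by rewrite -opprB dotpNl -dotpNr opprB; exact: H.
  - exact: H.
  - by rewrite subrr dotp0l.
by move=> x; exact: subsetUl.
Qed.

End Minty.

(** * Resolvents of maximally monotone operators and of [F + G] *)

Section Resolvents.
Set Implicit Arguments.
Unset Strict Implicit.
Variables (R : realType) (d : nat).
Local Notation V := 'rV[R]_d.
Implicit Types (A G : V -> set V) (F B : V -> V).

Lemma monotone_op_scale c A : 0 <= c -> monotone_op A -> monotone_op (op_scale c A).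
Proof.
move=> c0 Amon x y _ _ [u Au <-] [v Av <-].
by rewrite -scalerBr dotpZl mulr_ge0 // Amon.
Qed.

Lemma maximally_monotone_scale c A : 0 < c ->
  maximally_monotone A -> maximally_monotone (op_scale c A).
Proof.
move=> c0 [Amon Amax]; split; first by apply: monotone_op_scale => //; exact: ltW.
have cn0 : c != 0 by rewrite gt_eqF.
move=> B Bmon AB x b Bxb; exists (c^-1 *: b); last by rewrite scalerA mulfV ?scale1r.
apply: (Amax (op_scale c^-1 B)); last by exists b.
  by apply: monotone_op_scale => //; rewrite invr_ge0 ltW.
move=> y u Ayu; exists (c *: u); first by apply: AB; exists u.
by rewrite scalerA mulVf ?scale1r.
Qed.

Lemma resolventP A z : (exists p, A p (z - p)) ->
  A (resolvent A z) (z - resolvent A z).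
Proof. by move=> Ap; exact: (xgetPex 0 Ap). Qed.

Lemma resolvent_max_monotone A z : maximally_monotone A ->
  A (resolvent A z) (z - resolvent A z).
Proof. by move=> /minty Ap; exact: resolventP. Qed.

Lemma resolvent_nonexpansive A x y : maximally_monotone A ->
  enorm (resolvent A x - resolvent A y) <= enorm (x - y).
Proof.
move=> Amax; rewrite enorm_le ?enorm_ge0 // enorm_sqr.
have := resolvent_max_monotone x Amax; have := resolvent_max_monotone y Amax.
set p := resolvent A x; set q := resolvent A y => Aq Ap.
have := Amax.1 _ _ _ _ Ap Aq.
have -> : x - p - (y - q) = (x - y) - (p - q) by apply/rowP => i; rewrite !mxE; ring.
have := dotp_ge0 ((x - y) - (p - q)).
by move: (x - y) (p - q) => a b; rewrite !dotpE (dotpC b a); lra.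
Qed.

(** [F + G] need not be monotone, so [minty] is applied to [eta G] alone. Fixed points of
    [p |-> J_{eta G} (x - eta F p)] solve the inclusion, hence [xget] picks a genuine solution and
    not its default. *)
Lemma resolvent_sum F G L eta x : 0 <= L -> lipschitz_with F L ->
    maximally_monotone G -> 0 < eta -> eta * L < 1 ->
  let p := resolvent (op_scale eta (op_sum F G)) x in
  op_scale eta (op_sum F G) p (x - p).
Proof.
move=> L0 Flip Gmax eta0 etaL; apply: resolventP.
have etaGmax := maximally_monotone_scale eta0 Gmax.
pose T p := resolvent (op_scale eta G) (x - eta *: F p).
have [||p Tp] := @contraction_fixpoint _ _ T (eta * L).
- by rewrite etaL mulr_ge0 // ltW.
- move=> y z; apply: (le_trans (resolvent_nonexpansive _ _ etaGmax)).
  rewrite (_ : _ - _ = eta *: (F z - F y)); last first.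
    by apply/rowP => i; rewrite !mxE; ring.
  rewrite enormZ ?(ltW eta0) // -mulrA ler_pM2l // {2}/enorm dotpB_sym.
  exact: Flip.
have [u Gu Hu] := resolvent_max_monotone (x - eta *: F p) etaGmax.
exists p; exists (F p + u).
  by exists u => //; move: Gu; rewrite -/(T p) Tp.
by move: Hu; rewrite -/(T p) Tp scalerDr => ->; apply/rowP => i; rewrite !mxE; ring.
Qed.

End Resolvents.

(** * Linear convergence of the forward-backward-forward method *)

Section FBF.
Set Implicit Arguments.
Unset Strict Implicit.
Variables (R : realType) (d : nat).
Local Notation V := 'rV[R]_d.
Implicit Types (A G : V -> set V) (F B : V -> V).

(* With [p], [q] the vectors from the half step [w] to [z] and from [zs] to [w],
   the step gains [3/4 |p|^2 + kappa |q|^2], and [|3 p - 4 kappa q|^2 >= 0]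
   compares this gain with [|p + q|^2]. *)
Lemma fbf_step_contraction A B mu LB z zs : maximally_monotone A ->
    0 < mu -> 0 < LB ->
    (forall x y, mu * dotp (x - y) (x - y) <= dotp (B x - B y) (x - y)) ->
    (forall x y, dotp (B x - B y) (B x - B y) <= LB ^+ 2 * dotp (x - y) (x - y)) ->
    A zs (- B zs) ->
  (4 * (mu / LB) + 3) * dotp (fbf_step A B (2 * LB)^-1 z - zs) (fbf_step A B (2 * LB)^-1 z - zs)
    <= (mu / LB + 3) * dotp (z - zs) (z - zs).
Proof.
move=> Amax mu0 LB0 Bmon Blip Azs; rewrite /fbf_step.
set kappa := mu / LB.
set tau := (2 * LB)^-1.
have tau0 : 0 < tau by rewrite invr_gt0 mulr_gt0.
have Hk : 2 * tau * mu = kappa.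
  by rewrite /tau /kappa; field; rewrite gt_eqF.
have Ht : tau ^+ 2 * LB ^+ 2 = 4^-1.
  by rewrite /tau; field; rewrite gt_eqF.
have kappa0 : 0 < kappa by rewrite divr_gt0.
have tauAmax := maximally_monotone_scale tau0 Amax.
have Hw := resolvent_max_monotone (z - tau *: B z) tauAmax.
set w := resolvent (op_scale tau A) (z - tau *: B z) in Hw *.
have Hzs : op_scale tau A zs (- (tau *: B zs)) by exists (- B zs) => //; rewrite scalerN.
have mon := tauAmax.1 _ _ _ _ Hw Hzs.
have Bw := Bmon w zs; have BL := Blip z w.
have {}Bw : tau * (mu * dotp (w - zs) (w - zs)) <= tau * dotp (B w - B zs) (w - zs).
  by rewrite ler_pM2l.
have {}BL : tau ^+ 2 * dotp (B z - B w) (B z - B w) <= 4^-1 * dotp (z - w) (z - w).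
  by apply: le_trans (ler_wpM2l (sqr_ge0 tau) BL) _; rewrite mulrA Ht.
have sq := dotp_ge0 (3 *: (z - w) - (4 * kappa) *: (w - zs)).
have Ez : z - zs = (z - w) + (w - zs) by rewrite addrA subrK.
have EB : B z - B zs = (B z - B w) + (B w - B zs) by rewrite addrA subrK.
have E1 : z - tau *: B z - w - - (tau *: B zs) =
    (z - w) - tau *: ((B z - B w) + (B w - B zs)).
  by rewrite -EB; apply/rowP => i; rewrite !mxE; ring.
have E2 : w + tau *: B z - tau *: B w - zs = (w - zs) + tau *: (B z - B w).
  by apply/rowP => i; rewrite !mxE; ring.
rewrite E1 in mon; rewrite E2 Ez; clear E1 E2 Ez EB Hw Hzs.
move: (z - w) (w - zs) (B z - B w) (B w - B zs) mon Bw BL sq => p q b c.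
rewrite !dotpE !(dotpC b) !(dotpC q p) !(dotpC c) => mon Bw BL sq.
have {}Bw : kappa * dotp q q <= 2 * tau * dotp q c by rewrite -Hk; lra.
(* By [mon], [2 tau <q, b> <= 2 <p, q> - 2 tau <q, c>]; [Bw] turns the last term into
   [- kappa |q|^2], and [BL] bounds [tau^2 |b|^2] by [|p|^2 / 4]. *)
have : dotp q q + tau * dotp q b + (tau * dotp q b + tau * (tau * dotp b b)) <=
   dotp p p + 2 * dotp p q + dotp q q - 3 / 4 * dotp p p - kappa * dotp q q by lra.
have k3 : 0 < 4 * kappa + 3 by lra.
by move=> /(ler_wpM2l (ltW k3)); lra.
Qed.

(** Converts the rational factor of one step into an exponential, to be matched with the logarithm
    in [Nk]. *)
Lemma fbf_rate_le_expR (k : R) : 0 <= k <= 1 ->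
  (k + 3) / (4 * k + 3) <= expR (- (k / 2)).
Proof.
move=> /andP[k0 k1].
have k3 : 0 < 4 * k + 3 by lra.
have -> : - (k / 2) = 3%:R * - (k / 6) by field.
(* Cubing makes [1 - x <= expR (- x)] sharp enough at [k = 1]. *)
rewrite expRM_natl; apply: (@le_trans _ _ ((1 - k / 6) ^+ 3)); last first.
  rewrite lerXn2r ?nnegrE ?expR_ge0 //; [lra|exact: expR_ge1Dx].
rewrite ler_pdivrMr //.
have -> : (1 - k / 6) ^+ 3 * (4 * k + 3) =
  k + 3 + k * (3/2 - 7/4 * k + 23/72 * k ^+ 2 - k ^+ 3 / 54) by field.
rewrite lerDl mulr_ge0 //.
have : 0 <= (1 - k) * k by apply: mulr_ge0; lra.
have : 0 <= (1 - k) * k ^+ 2 by apply: mulr_ge0; [lra|exact: sqr_ge0].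
have := sqr_ge0 (1 - k); nra.
Qed.

(** The shift by [z0] cancels in differences, so [Bin - z0] inherits the constants of [Bin], and
    [zs] is a zero of [A + Bin - z0]. *)
Lemma FBF_convergence A Bin mu LB z0 zs N : maximally_monotone A ->
    0 < mu <= LB ->
    (forall x y, mu * dotp (x - y) (x - y) <= dotp (Bin x - Bin y) (x - y)) ->
    (forall x y, dotp (Bin x - Bin y) (Bin x - Bin y) <= LB ^+ 2 * dotp (x - y) (x - y)) ->
    A zs (z0 - Bin zs) ->
  dotp (FBF z0 N A Bin LB - zs) (FBF z0 N A Bin LB - zs)
    <= expR (- (mu / LB / 2)) ^+ N * dotp (z0 - zs) (z0 - zs).
Proof.
move=> Amax /andP[mu0 muLB] Bmon Blip Azs.
have LB0 : 0 < LB by exact: lt_le_trans muLB.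
rewrite /FBF /FBF_counted; set step := (X in iter _ X).
elim: N => [|N IH]; first by rewrite expr0 mul1r.
rewrite iterS; set c := iter N _ _ in IH *.
rewrite /step /= exprS -mulrA.
set B := fun z => Bin z - z0.
have EB x y : B x - B y = Bin x - Bin y by rewrite /B opprB addrA subrK.
have Bmon' x y : mu * dotp (x - y) (x - y) <= dotp (B x - B y) (x - y) by rewrite EB.
have Blip' x y : dotp (B x - B y) (B x - B y) <= LB ^+ 2 * dotp (x - y) (x - y).
  by rewrite EB.
have Azs' : A zs (- B zs) by rewrite /B opprB.
have H := fbf_step_contraction c.1.1 Amax mu0 LB0 Bmon' Blip' Azs'.
have k0 : 0 < mu / LB by rewrite divr_gt0.
have k1 : mu / LB <= 1 by rewrite ler_pdivrMr ?mul1r.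
have k3 : 0 < 4 * (mu / LB) + 3 by lra.
apply: (@le_trans _ _ ((mu / LB + 3) / (4 * (mu / LB) + 3) * dotp (c.1.1 - zs) (c.1.1 - zs))).
  by rewrite mulrAC ler_pdivlMr // mulrC.
apply: ler_pM => //; rewrite ?dotp_ge0 ?divr_ge0 ?fbf_rate_le_expR ?(ltW k0) //; lra.
Qed.

Lemma forward_monotone F L eta x y : 0 <= eta -> 0 <= L -> lipschitz_with F L ->
  (1 - eta * L) * dotp (x - y) (x - y) <=
    dotp (x + eta *: F x - (y + eta *: F y)) (x - y).
Proof.
move=> eta0 L0 Flip; have := dotp_le_of_sqr L0 (lipschitz_with_sqr Flip x y).
rewrite ler_norml => /andP[H _].
have {}H : eta * - (L * dotp (x - y) (x - y)) <= eta * dotp (F x - F y) (x - y).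
  by rewrite ler_wpM2l.
rewrite opprD addrACA -scalerBr.
by move: (x - y) (F x - F y) H => p b; rewrite !dotpE; lra.
Qed.

Lemma forward_lipschitz_sqr F L eta x y : 0 <= eta -> 0 <= L -> lipschitz_with F L ->
  dotp (x + eta *: F x - (y + eta *: F y)) (x + eta *: F x - (y + eta *: F y))
    <= (1 + eta * L) ^+ 2 * dotp (x - y) (x - y).
Proof.
move=> eta0 L0 Flip; have Fxy := lipschitz_with_sqr Flip x y.
have := dotp_le_of_sqr L0 Fxy.
rewrite ler_norml => /andP[_ H].
have {}H : eta * dotp (F x - F y) (x - y) <= eta * (L * dotp (x - y) (x - y)).
  by rewrite ler_wpM2l.
have {}Fxy : eta ^+ 2 * dotp (F x - F y) (F x - F y)
    <= eta ^+ 2 * (L ^+ 2 * dotp (x - y) (x - y)) by rewrite ler_wpM2l // sqr_ge0.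
rewrite opprD addrACA -scalerBr.
move: (x - y) (F x - F y) H Fxy => p b; rewrite !dotpE (dotpC p b); lra.
Qed.

End FBF.

(** * The error weights, their sum, and the choice of [Nk] *)

Section InexactKM.
Set Implicit Arguments.
Unset Strict Implicit.
Variables (R : realType).

(** Inverse of the argument of the logarithm in [Nk]; it serves as the relative error of the inexact
    resolvent. *)
Definition km_error (k : nat) : R := (8 * k.+1%:R * ln k.+2%:R ^+ 2)^-1.

Lemma ln2_ge : 2^-1 <= ln 2 :> R.
Proof.
rewrite -ler_expR lnK ?posrE //.
have H : 2^-1 <= expR (- 2^-1) :> R by have := expR_ge1Dx (- 2^-1 : R); lra.
by rewrite -(opprK (2^-1)) expRN invf_ple ?posrE ?expR_gt0.
Qed.

Lemma ln_natSS_ge k : 2^-1 <= ln k.+2%:R :> R.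
Proof. by apply: le_trans ln2_ge _; rewrite ler_ln ?posrE // ler_nat. Qed.

Lemma ln_natSS_gt0 k : 0 < ln k.+2%:R :> R.
Proof. by apply: lt_le_trans (ln_natSS_ge k). Qed.

Lemma ln_natS_diff_ge m : (0 < m)%N -> m.+1%:R^-1 <= ln m.+1%:R - ln m%:R :> R.
Proof.
move=> m0; have m0' : 0 < m%:R :> R by rewrite ltr0n.
have mS : 0 < m.+1%:R :> R by [].
rewrite -[X in _ <= X]opprB lerNr -ln_div ?posrE //.
have -> : m%:R / m.+1%:R = 1 + - m.+1%:R^-1 :> R.
  by rewrite -natr1; field; rewrite natr1 gt_eqF.
apply: le_ln1Dx; rewrite ltrN2 invf_lt1 //.
by rewrite ltr1n ltnS.
Qed.

Lemma km_error_gt0 k : 0 < km_error k.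
Proof. by rewrite invr_gt0 !mulr_gt0 ?exprn_gt0 ?ln_natSS_gt0. Qed.

Lemma km_error_le_half k : km_error k <= 2^-1.
Proof.
have := km_error_gt0 k; rewrite /km_error invr_gt0 => W0.
rewrite lef_pV2 ?posrE //.
have H : 4^-1 <= ln k.+2%:R ^+ 2 :> R.
  rewrite (_ : 4^-1 = 2^-1 ^+ 2 :> R); last by field.
  by rewrite lerXn2r ?nnegrE ?ln_natSS_ge // ltW ?ln_natSS_gt0.
have H1 : 1 <= k.+1%:R :> R by rewrite ler1n.
have : 1 * 4^-1 <= k.+1%:R * ln k.+2%:R ^+ 2 :> R by apply: ler_pM.
lra.
Qed.

(** Discrete form of [1 / (x ln^2 x)] being the derivative of [- 1 / ln x]. The factor 3/16 is 1/8
    times 3/2, the largest value of [(n + 3) / (n + 2)], taken at [n = 0]. *)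
Lemma km_error_telescope k :
  km_error k.+1 <= 3 / 16 * ((ln k.+2%:R)^-1 - (ln k.+3%:R)^-1).
Proof.
have a0 := ln_natSS_gt0 k; have b0 := ln_natSS_gt0 k.+1.
have := @ln_natS_diff_ge k.+2 isT.
rewrite /km_error; set a := ln k.+2%:R in a0 *; set b := ln k.+3%:R in b0 *.
have k0 : 0 <= k%:R :> R by rewrite ler0n.
have -> : k.+3%:R = k%:R + 3 :> R by rewrite -!natr1; ring.
have -> : k.+2%:R = k%:R + 2 :> R by rewrite -!natr1; ring.
move: (k%:R : R) k0 => n n0 H.
have ab : a <= b by rewrite -subr_ge0; apply: le_trans H; rewrite invr_ge0; lra.
have n2 : 0 < n + 2 by lra.
have n3 : 0 < n + 3 by lra.
have E : a^-1 - b^-1 = (b - a) / (a * b) by field; rewrite !gt_eqF.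
rewrite E.
apply: (@le_trans _ _ (3 / 16 * ((n + 3)^-1 / (b * b)))); last first.
  rewrite ler_pM2l //; apply: ler_pM => //.
  - by rewrite invr_ge0 ltW.
  - by rewrite invr_ge0 mulr_ge0 ?ltW.
  - by rewrite lef_pV2 ?posrE ?mulr_gt0 // ler_pM2r.
have -> : (8 * (n + 2) * b ^+ 2)^-1 = 8^-1 * (n + 2)^-1 / (b * b).
  by field; rewrite !gt_eqF.
rewrite mulrA ler_pM2r ?invr_gt0 ?mulr_gt0 //.
rewrite -[X in _ <= X / _]mulr1 -subr_ge0.
have -> : 3 / 16 * 1 / (n + 3) - 8^-1 / (n + 2) = n / (16 * (n + 2) * (n + 3)).
  by field; rewrite !gt_eqF.
by rewrite divr_ge0 // !mulr_ge0 // ltW.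
Qed.

Lemma km_error_sum K : \sum_(k < K) km_error k <= 7 / 8.
Proof.
case: K => [|K]; first by rewrite big_ord0; lra.
(* The first weight is bounded apart by 1/2, and the telescoped rest by [3 / 16 * 2]. The negative
   term is kept for the induction. *)
apply: (@le_trans _ _ (2^-1 + 3 / 16 * ((ln 2)^-1 - (ln K.+2%:R)^-1))); last first.
  have : (ln 2)^-1 <= 2 :> R.
    by rewrite invf_ple ?posrE ?ln2_ge //; exact: (ln_natSS_gt0 0).
  have : 0 < (ln K.+2%:R)^-1 :> R by rewrite invr_gt0 ln_natSS_gt0.
  lra.
elim: K => [|K IH].
  by rewrite big_ord_recr big_ord0 /= subrr mulr0 addr0 add0r km_error_le_half.
rewrite big_ord_recr /=; have := km_error_telescope K; lra.
Qed.

Lemma expR_km_error_sum K : expR (\sum_(k < K) km_error k) <= 8.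
Proof.
have H : 8^-1 <= expR (- (7 / 8)) :> R by have := expR_ge1Dx (- (7 / 8) : R); lra.
apply: (@le_trans _ _ (expR (7 / 8))); first by rewrite ler_expR km_error_sum.
by rewrite -(opprK (7 / 8)) expRN invf_ple ?posrE ?expR_gt0.
Qed.

(** The prefactor in [Nk] times the rate [(1 - c) / (1 + c) / 2] equals 2, hence the square of
    [km_error]. *)
Lemma expR_Nk_le eta L k : 0 <= eta * L < 1 ->
  expR (- ((1 - eta * L) / (1 + eta * L) / 2)) ^+ Nk eta L k <= km_error k ^+ 2.
Proof.
move=> /andP[c0 c1]; rewrite /Nk /km_error.
set c := eta * L in c0 c1 *; set W := 8 * _ * _.
have W0 : 0 < W by rewrite !mulr_gt0 ?exprn_gt0 ?ln_natSS_gt0.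
set X := 4 * _ / _ * _; set N := `|_|%N.
have XN : X <= N%:R.
  (* The absolute value in [Nk] can only enlarge the ceiling, whatever its sign. *)
  by rewrite (le_trans (ceil_ge X)) // /N natr_absz ler_int ler_norm.
have -> : W^-1 ^+ 2 = expR (- (2 * ln W)).
  by rewrite expRN expRM_natl lnK ?posrE // exprVn.
rewrite -expRM_natr ler_expR mulNr lerN2.
have -> : 2 * ln W = (1 - c) / (1 + c) / 2 * X.
  by rewrite /X; field; rewrite !gt_eqF //; lra.
by rewrite ler_wpM2l // !divr_ge0 //; lra.
Qed.

(** * Descent of the inexact KM iteration and the oracle count *)

Variable d : nat.
Local Notation V := 'rV[R]_d.
Implicit Types (G : V -> set V) (F : V -> V).
Local Notation J eta F G x := (resolvent (op_scale eta (op_sum F G)) x).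

(** The exact resolvent [p] is the zero targeted by FBF, and FBF starts at [x], so the error is
    relative to [|x - p|]. *)
Lemma inexact_resolvent_error F G L eta k x : 0 <= L -> lipschitz_with F L ->
    maximally_monotone G -> 0 < eta -> eta * L < 1 ->
  dotp (inexact_resolvent F G L eta k x - J eta F G x)
       (inexact_resolvent F G L eta k x - J eta F G x)
    <= km_error k ^+ 2 * dotp (x - J eta F G x) (x - J eta F G x).
Proof.
move=> L0 Flip Gmax eta0 etaL; set p := J eta F G x.
have c0 : 0 <= eta * L by rewrite mulr_ge0 // ltW.
have := resolvent_sum x L0 Flip Gmax eta0 etaL; rewrite -/p => -[_ [u Gu <-] Hu].
apply: (@le_trans _ _ (expR (- ((1 - eta * L) / (1 + eta * L) / 2)) ^+ Nk eta L k
  * dotp (x - p) (x - p))); last first.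
  by rewrite ler_wpM2r ?dotp_ge0 // expR_Nk_le // c0.
apply: FBF_convergence.
- exact: maximally_monotone_scale.
- lra.
- by move=> y z; apply: forward_monotone => //; exact: ltW.
- by move=> y z; apply: forward_lipschitz_sqr => //; exact: ltW.
- by exists u => //; rewrite opprD addrA -Hu scalerDr addrAC subrr add0r.
Qed.

Lemma km_step_descent F G rho eta e x y p xs : 0 < rho -> rho < eta ->
    weak_MVI (op_sum F G) rho xs -> 0 < e <= 2^-1 ->
    op_scale eta (op_sum F G) p (x - p) ->
    dotp (y - p) (y - p) <= e ^+ 2 * dotp (x - p) (x - p) ->
  forall alpha, alpha = 1 - rho / eta ->
  dotp ((1 - alpha) *: x + alpha *: y - xs) ((1 - alpha) *: x + alpha *: y - xs)
    + 3 / 4 * (alpha ^+ 2 * dotp (x - p) (x - p))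
    <= (1 + e) * dotp (x - xs) (x - xs).
Proof.
move=> rho0 rho_eta mvi /andP[e0 e1] [u Hu Eu] Hy alpha alphaE.
have eta0 : 0 < eta by lra.
have alpha0 : 0 < alpha by rewrite alphaE subr_gt0 ltr_pdivrMr ?mul1r.
have H := mvi _ _ Hu; rewrite enorm_sqr in H.
(* The weak MVI is used at [p] with [u = (x - p) / eta]; its loss [rho / eta] is what turns 1 into
   [alpha]. *)
have {}H : alpha * dotp (x - p) (x - p) <= dotp (x - p) (x - xs).
  have -> : x - xs = (p - xs) + (x - p) by rewrite [RHS]addrC addrA subrK.
  rewrite -Eu !dotpE in H *.
  have {}H := ler_wpM2l (ltW eta0) H.
  have -> : alpha * (eta * (eta * dotp u u)) = eta * eta * dotp u u - rho * eta * dotp u u.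
    by rewrite alphaE; field; rewrite gt_eqF.
  lra.
have -> : (1 - alpha) *: x + alpha *: y - xs = (x - xs) - alpha *: (x - p) + alpha *: (y - p).
  by apply/rowP => i; rewrite !mxE; ring.
move: (x - xs) (x - p) (y - p) H Hy => q r f H Hy.
have {}H := ler_wpM2l (ltW alpha0) H.
set w := q - alpha *: r.
have ww : dotp w w <= dotp q q - alpha ^+ 2 * dotp r r.
  by rewrite /w !dotpE (dotpC q r); lra.
have ff : alpha ^+ 2 * dotp f f <= alpha ^+ 2 * (e ^+ 2 * dotp r r).
  by rewrite ler_wpM2l // sqr_ge0.
(* Young's inequality with weight [e]. Its last term is cancelled by the gain in [e * ww], so only
   the [e ^+ 2 <= 1/4] part of the descent is lost, leaving 3/4. *)
have young : 2 * alpha * dotp w f <= e * dotp w w + e * (alpha ^+ 2 * dotp r r).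
  rewrite -(ler_pM2l e0).
  move: (w) ff => v ff.
  have := dotp_ge0 (e *: v - alpha *: f); rewrite !dotpE (dotpC f v); lra.
have rr : 0 <= alpha ^+ 2 * dotp r r by rewrite mulr_ge0 ?sqr_ge0 ?dotp_ge0.
have e2 : e ^+ 2 * (alpha ^+ 2 * dotp r r) <= 4^-1 * (alpha ^+ 2 * dotp r r).
  rewrite ler_wpM2r // (_ : 4^-1 = 2^-1 ^+ 2 :> R); last by field.
  by rewrite lerXn2r ?nnegrE // ltW.
have ew := ler_wpM2l (ltW e0) ww.
clearbody w.
by rewrite !dotpE (dotpC f w); lra.
Qed.

(** A discrete Gronwall argument: the factors [1 + km_error k] are absorbed into the exponential of
    their sum. *)
Lemma km_sum_bound F G L eta rho x0 xs K :
    0 <= L -> lipschitz_with F L -> maximally_monotone G ->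
    0 < rho -> eta * L < 1 -> rho < eta -> weak_MVI (op_sum F G) rho xs ->
  dotp (KM F G L eta rho x0 K - xs) (KM F G L eta rho x0 K - xs)
    + 3 / 4 * \sum_(k < K) ((1 - rho / eta) ^+ 2 *
        dotp (KM F G L eta rho x0 k - J eta F G (KM F G L eta rho x0 k))
             (KM F G L eta rho x0 k - J eta F G (KM F G L eta rho x0 k)))
  <= expR (\sum_(k < K) km_error k) * dotp (x0 - xs) (x0 - xs).
Proof.
move=> L0 Flip Gmax rho0 etaL rho_eta mvi; set x := KM F G L eta rho x0.
pose r k := x k - J eta F G (x k).
have eta0 : 0 < eta by lra.
elim: K => [|K IH]; first by rewrite !big_ord0 expR0 mulr0 addr0 mul1r.
rewrite !big_ord_recr /= expRD.
have e0 := km_error_gt0 K.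
have eK : 0 < km_error K <= 2^-1 by rewrite e0 km_error_le_half.
have := km_step_descent rho0 rho_eta mvi eK
  (resolvent_sum (x K) L0 Flip Gmax eta0 etaL)
  (inexact_resolvent_error K (x K) L0 Flip Gmax eta0 etaL) erefl.
rewrite -/(r K) -/(x K.+1).
set s := \sum_(k < K) _ in IH *; set E := expR _ in IH *.
have s0 : 0 <= s by rewrite sumr_ge0 // => k _; rewrite mulr_ge0 ?sqr_ge0 ?dotp_ge0.
have e1 := expR_ge1Dx (km_error K).
have D0 := dotp_ge0 (x0 - xs).
have : E * dotp (x0 - xs) (x0 - xs) * (1 + km_error K) <=
       E * dotp (x0 - xs) (x0 - xs) * expR (km_error K).
  by rewrite ler_wpM2l // mulr_ge0 ?expR_ge0.
have e1' : 0 <= 1 + km_error K by lra.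
have := ler_wpM2l e1' IH.
(* Multiplying the induction hypothesis by [1 + km_error K] also enlarges the old sum; this excess
   is dropped. *)
have : 0 <= km_error K * s by rewrite mulr_ge0 // ltW.
lra.
Qed.

(** Each step evaluates [F] twice and one resolvent, so the maximum of the two counters is that of
    [F]. *)
Lemma oracle_calls_at_eq F G L eta k x :
  oracle_calls_at F G L eta k x = (2 * Nk eta L k)%N.
Proof.
rewrite /oracle_calls_at /FBF_oracle_calls /FBF_counted.
set step := (X in iter _ X).
have H N : (iter N step (x, 0, 0)%N).1.2 = (2 * N)%N /\ (iter N step (x, 0, 0)%N).2 = N.
  by elim: N => [//|N [H1 H2]]; rewrite iterS /step /= -/step H1 H2 addn1 mulnS addnC.
have [-> ->] := H (Nk eta L k).
by apply/maxn_idPl; rewrite leq_pmull.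
Qed.

End InexactKM.

Theorem theorem3p1 (R : realType) (d : nat)
  (F : 'rV[R]_d -> 'rV[R]_d) (G : 'rV[R]_d -> set 'rV[R]_d)
  (L eta rho : R) (x0 xs : 'rV[R]_d) :
  0 <= L -> lipschitz_with F L -> maximally_monotone G ->
  0 < rho -> eta * L < 1 -> rho < eta ->
  op_sum F G xs 0 -> weak_MVI (op_sum F G) rho xs ->
  (forall K : nat, (1 <= K)%N ->
     K%:R^-1 * \sum_(k < K)
        (eta ^- 2 * enorm (KM F G L eta rho x0 k
             - resolvent (op_scale eta (op_sum F G)) (KM F G L eta rho x0 k)) ^+ 2)
     <= 11 * enorm (x0 - xs) ^+ 2 / ((eta - rho) ^+ 2 * K%:R))
  /\ (forall k : nat,
        (oracle_calls_at F G L eta k (KM F G L eta rho x0 k) <= 2 * Nk eta L k)%N).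
Proof.
move=> L0 Flip Gmax rho0 etaL rho_eta _ mvi; split; last first.
  by move=> k; rewrite oracle_calls_at_eq.
move=> K K1; have eta0 : 0 < eta by exact: lt_trans rho_eta.
have er0 : 0 < eta - rho by rewrite subr_gt0.
have K0 : 0 < K%:R :> R by rewrite ltr0n.
set x := KM F G L eta rho x0.
have := km_sum_bound x0 K L0 Flip Gmax rho0 etaL rho_eta mvi; rewrite /= -/x.
have := ler_wpM2r (dotp_ge0 (x0 - xs)) (expR_km_error_sum R K).
have := dotp_ge0 (x K - xs); have := dotp_ge0 (x0 - xs).
(* Uses [1 - rho / eta = (eta - rho) / eta]. *)
have -> : \sum_(k < K) ((1 - rho / eta) ^+ 2 *
     dotp (x k - resolvent (op_scale eta (op_sum F G)) (x k))
          (x k - resolvent (op_scale eta (op_sum F G)) (x k))) =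
  (eta - rho) ^+ 2 * \sum_(k < K)
     (eta ^- 2 * enorm (x k - resolvent (op_scale eta (op_sum F G)) (x k)) ^+ 2).
  rewrite mulr_sumr; apply: eq_bigr => k _; rewrite enorm_sqr.
  by field; rewrite gt_eqF.
set s := \sum_(k < K) (eta ^- 2 * _) => D0 DK Hexp Hsum.
rewrite enorm_sqr ler_pdivlMr ?mulr_gt0 ?exprn_gt0 //.
have -> : K%:R^-1 * s * ((eta - rho) ^+ 2 * K%:R) = (eta - rho) ^+ 2 * s.
  by field; rewrite gt_eqF.
lra.
Qed.
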